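(* There are positive constants $c$, $c'$ such that for every positive integer $f$ $$c\,2^{\frac{1}{3} f}<MED(f)<c'\,2^{0.41385f},$$ where $MED(f)$ is the number of max embedding dimension numerical semigroups with Frobenius number $f$.
   Context: A numerical semigroup is a subset $S\subseteq\mathbb{N}=\{0,1,2,\dots\}$ that contains $0$, is closed under addition, and has finite complement in $\mathbb{N}$. The Frobenius number $f(S)$ is the largest element of $\mathbb{N}\setminus S$. The multiplicity $m(S)$ is the smallest non-zero element of $S$. Each numerical semigroup has a unique minimal set of generators; the number of these generators is the embedding dimension $e(S)$. One always has $e(S)\le m(S)$, and $S$ is said to be of max embedding dimension if $e(S)=m(S)$. *)

(* Defs.v *)
From mathcomp Require Import all_boot all_order all_algebra.
From mathcomp Require Import finmap.
From mathcomp Require Import all_classical all_reals all_analysis.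

Set Implicit Arguments.
Unset Strict Implicit.
Unset Printing Implicit Defensive.

Local Open Scope classical_set_scope.
Local Open Scope nat_scope.

Definition submonoid (S : set nat) : Prop :=
  S 0 /\ forall x y : nat, S x -> S y -> S (x + y).

Definition numerical_semigroup (S : set nat) : Prop :=
  submonoid S /\ finite_set (~` S).

(* f(S) is undefined for S = setT: no f satisfies the relation then. *)
Definition is_frobenius_number (S : set nat) (f : nat) : Prop :=
  ~ S f /\ forall x : nat, ~ S x -> x <= f.

Definition is_multiplicity (S : set nat) (m : nat) : Prop :=
  [/\ S m, m <> 0 & forall x : nat, S x -> x <> 0 -> m <= x].

Definition generates (A S : set nat) : Prop := smallest submonoid A = S.

Definition minimal_generators (A S : set nat) : Prop :=
  generates A S /\ forall B : set nat, B `<=` A -> generates B S -> B = A.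

Definition is_embedding_dimension (S : set nat) (e : nat) : Prop :=
  exists A : set nat, minimal_generators A S /\ (A #= `I_e)%card.

Definition max_embedding_dimension (S : set nat) : Prop :=
  exists e : nat, is_embedding_dimension S e /\ is_multiplicity S e.

Definition MED_semigroups (f : nat) : set (set nat) :=
  [set S | [/\ numerical_semigroup S, is_frobenius_number S f
             & max_embedding_dimension S]].

(* fset_set is meaningful on finite sets only; MED_semigroups f is finite,
   since S is determined by its trace on [0, f] once f(S) = f. *)
Definition MED (f : nat) : nat := #|` fset_set (MED_semigroups f)|.

(* Main.v *)
Require Import Defs.
From mathcomp Require Import all_boot all_order all_algebra.
From mathcomp Require Import finmap.
From mathcomp Require Import all_classical all_reals all_analysis.
From mathcomp Require Import zify ring lra.

(* Write S* = S \ {0}. A numerical semigroup S of multiplicity m has maximal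
   embedding dimension iff x + y - m is in S for all x, y in S*, i.e. iff
   T = S* - m is again a semigroup, of Frobenius number g = f - m.

   Upper bound. Let U be a set of integers >= w, closed under adding w and
   without two elements of sum h + d w, where d is 0 or 1. It is given by its
   least element in each class modulo w; when a class has k elements in [0, h],
   this leaves k choices, and the choices for the classes of r and h - r
   constrain each other. For d = 0 a pair of classes leaves at most 2^k choices,
   for d = 1 exactly k(k+1)/2. The k's add up to h + 1, so for d = 0 the number
   of such U in [0, h] is at most 2^((h+1)/2). Take
   - U = T \ {0}, w the multiplicity of T, h = g, d = 0 when m > f/5:
     about 2^(g/2) <= 2^(2f/5) choices;
   - U = S*, w = m, h = f, d = 1 when m <= f/5: then k >= 5, so
     k(k+1)/2 <= 2^(4k/5), and there are about 2^(2f/5) choices again.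
   The sum over m and over the multiplicity of T only costs a polynomial factor,
   and 2/5 < 0.41385.

   Lower bound. With m close to f/3, adding to {0, m, 2m} and (f, oo) any subset
   of (2m, f) gives a semigroup of maximal embedding dimension. *)

Set Implicit Arguments.
Unset Strict Implicit.
Unset Printing Implicit Defensive.

(** * Choices for two classes that constrain each other *)

Lemma card_ord_itv_le (n lo k : nat) :
  #|[set b : 'I_n | lo <= b <= k]| <= k.+1 - lo.
Proof.
rewrite cardE -(size_map val) -(size_iota lo (k.+1 - lo)).
apply: uniq_leq_size.
  by rewrite map_inj_uniq ?enum_uniq //; exact: val_inj.
move=> x /mapP[b]; rewrite mem_enum inE mem_iota => /andP[? ?] ->.
by apply/andP; split => //=; lia.
Qed.

(** The number of pairs in [1, k]^2 of sum at least k + d, sorted by the first entry a; the cap k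
    takes effect only for d = 0 and a = k. *)
Definition pair_count (d k : nat) : nat := \sum_(1 <= a < k.+1) minn (a + 1 - d) k.

Lemma card_pairs_le (n d k : nat) : k < n ->
  #|[set p : 'I_n * 'I_n | [&& 1 <= p.1 <= k, 1 <= p.2 <= k & k + d <= p.1 + p.2]]|
    <= pair_count d k.
Proof.
move=> kn; rewrite -sum1_card.
rewrite (eq_bigl (fun p : 'I_n * 'I_n => (1 <= p.1 <= k) &&
   ((1 <= p.2 <= k) && (k + d <= p.1 + p.2)))); last by move=> p; rewrite inE.
rewrite -(pair_big_dep (fun a : 'I_n => 1 <= a <= k)
  (fun a b : 'I_n => (1 <= b <= k) && (k + d <= a + b)) (fun _ _ => 1)) /=.
rewrite /pair_count (big_nat_widenl 1 0) // big_mkord /=.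
rewrite (big_ord_widen_cond n (fun a => 1 <= a) (fun a => minn (a + 1 - d) k)) //.
apply: leq_sum => a /andP[a1 ak].
rewrite sum1_card.
apply: leq_trans (_ : #|[set b : 'I_n | maxn 1 (k + d - a) <= b <= k]| <= _).
  apply: subset_leq_card; apply/fintype.subsetP => b; rewrite !inE => /andP[/andP[? ->]].
  by rewrite andbT; lia.
by apply: leq_trans (card_ord_itv_le _ _ _) _; lia.
Qed.

Lemma pair_count1 (k : nat) : pair_count 1 k = 'C(k.+1, 2).
Proof.
rewrite /pair_count -bin2_sum [RHS]big_nat_recl // add0n big_add1 /=.
by apply: eq_big_nat => a ak; lia.
Qed.

(** Fifth powers clear the exponent 4k/5. The bound fails at k = 3 and k = 4, hence an induction
    from 5; k = 1 serves the multiplicity f + 1. *)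
Lemma pair_count1_le (k : nat) : k = 1 \/ 5 <= k -> pair_count 1 k ^ 5 <= 16 ^ k.
Proof.
rewrite pair_count1 => -[-> //|k5].
have main : (k * k.+1) ^ 5 <= 32 * 16 ^ k.
  elim: k k5 => // k IH; rewrite ltnS leq_eqVlt => /orP[/eqP <-|k5].
    by vm_compute.
  have {}IH := IH k5.
  (* Here (k + 2)/k <= 3/2, and (3/2)^5 = 243/32 < 16. *)
  have h : (2 * (k.+1 * k.+2)) ^ 5 <= (3 * (k * k.+1)) ^ 5.
    rewrite leq_exp2r // mulnCA [k * _]mulnC [3 * _]mulnCA leq_mul2l /=; lia.
  rewrite (expnMn 2) (expnMn 3) in h.
  rewrite [16 ^ k.+1]expnS.
  move: IH h; rewrite (_ : 2 ^ 5 = 32) // (_ : 3 ^ 5 = 243) //.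
  by move: ((k * k.+1) ^ 5) ((k.+1 * k.+2) ^ 5) (16 ^ k) => x y z; lia.
have : 32 * 'C(k.+1, 2) ^ 5 <= 32 * 16 ^ k.
  apply: leq_trans main; rewrite (_ : 32 = 2 ^ 5) // -expnMn leq_exp2r //.
  by rewrite mulnC -[X in _ * X]/(2`!) bin_ffact; rewrite ffactnS ffactn1 mulnC.
by rewrite leq_pmul2l.
Qed.

(** The terms are 2, ..., k and a last k, of sum (k^2 + 3k - 2)/2; this equals 2^k at k = 2 and k =
    3. *)
Lemma pair_count0_le (k : nat) : 0 < k -> pair_count 0 k <= 2 ^ k.
Proof.
case: k => // k _; rewrite /pair_count big_nat_recr //=.
rewrite (eq_big_nat _ _ (F2 := fun a => a.+1)); last first.
  by move=> a /andP[_ ak]; lia.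
rewrite (minn_idPr _); last by lia.
elim: k => [|k IH]; first by rewrite big_geq.
rewrite big_nat_recr //=.
case: k IH => [_|k IH]; first by rewrite big_geq.
have := ltn_expl k.+1 (isT : 1 < 2).
rewrite (expnS 2 k.+2) (expnS 2 k.+1) in IH *.
by move: IH; move: (\sum_(_ <= _ < _) _) => s; lia.
Qed.

(** * Counting sets by their least elements modulo w *)

(** Hermite's identity: passing from n to n + 1 trades the summand [n %/ w] for [(n + w) %/ w],
    which is one larger. *)
Lemma sum_divn_shift (w n : nat) : 0 < w -> \sum_(r < w) (n + r) %/ w = n.
Proof.
move=> w0; elim: n => [|n IH].
  by rewrite big1 // => r _; rewrite divn_small ?add0n.
case: w w0 IH => // w w0 IH.
rewrite big_ord_recr /= -[in RHS]IH [in RHS]big_ord_recl /=.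
rewrite addn0 addSnnS (_ : n + w.+1 = 1 * w.+1 + n) ?divnMDl //; last by lia.
rewrite [LHS]addnC add1n addSn; congr (_.+1 + _).
by apply: eq_bigr => r _; rewrite addSnnS.
Qed.

(* Number of elements of [0, h] congruent to r modulo w, for r < w, r <= h. *)
Definition class_size (w h r : nat) : nat := ((h - r) %/ w).+1.

Lemma sum_class_size (w h : nat) : 0 < w -> w <= h.+1 ->
  \sum_(r < w) class_size w h r = h.+1.
Proof.
move=> w0 wh; rewrite -[RHS](sum_divn_shift h.+1 w0) (reindex_inj rev_ord_inj) /=.
apply: eq_bigr => r _; rewrite /class_size.
have rw := ltn_ord r.
by rewrite (_ : h.+1 + r = 1 * w + (h - (w - r.+1))) ?divnMDl //; lia.
Qed.

(* Interleaving two elements [x], [y] of [P], using [x] on one half of the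
   orbits of [s] and [y] on the other, makes each factor [Q r] serve once for
   every residue although [Q r] constrains the two values at [r] and [s r]. *)
Lemma card_sqr_le_prod (X V : finType) (w : nat) (P : {set X})
    (s : 'I_w -> 'I_w) (code : X -> 'I_w -> V) (Q : 'I_w -> {set V * V}) :
  involutive s ->
  {in P &, forall x y, code x =1 code y -> x = y} ->
  {in P, forall x r, (code x r, code x (s r)) \in Q r} ->
  {in P &, forall x y r, s r = r -> (code x r, code y r) \in Q r} ->
  #|P| ^ 2 <= \prod_(r < w) #|Q r|.
Proof.
move=> sK code_inj Q1 Q2.
(* Both entries come from x if r < s r and from y if r > s r; a fixed point of s takes one entry
   from each, which is the case left to the last hypothesis on [Q]. *)
pose F (p : X * X) : {ffun 'I_w -> V * V} := [ffun r : 'I_w =>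
  (code (if r <= s r then p.1 else p.2) r,
   code (if r < s r then p.1 else p.2) (s r))].
have FP p r : (F p r = (code (if r <= s r then p.1 else p.2) r,
   code (if r < s r then p.1 else p.2) (s r))) by rewrite ffunE.
have F_inj : {in finset.setX P P &, injective F}.
  move=> [x y] [x' y'] /finset.setXP[/= xP yP] /finset.setXP[/= x'P y'P] eF.
  have e1 r : (F (x, y) r).1 = (F (x', y') r).1 by rewrite eF.
  have e2 r : (F (x, y) r).2 = (F (x', y') r).2 by rewrite eF.
  congr (_, _); apply: code_inj => // r;
    have := e1 r; have := e2 (s r); rewrite !FP /= sK.
    by case: (leqP r (s r)).
  by case: (ltngtP r (s r)).
rewrite -mulnn -cardsX -(card_in_imset F_inj).
apply: leq_trans (_ : #|family Q| <= _).
  apply: subset_leq_card; apply/fintype.subsetP => _ /imsetP[[x y] /finset.setXP[xP yP] ->].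
  apply/familyP => r; rewrite FP /=.
  case: (ltngtP r (s r)) => rs; [exact: Q1|exact: Q1|].
  have e : s r = r by apply: val_inj.
  by rewrite e; apply: Q2.
by rewrite card_family foldrE big_map big_enum.
Qed.

(* The code of a subset is the number of its non-elements in each class
   modulo [w]; the classes of [r] and [(h - r) %% w] constrain each other. *)
Lemma card_sqr_le_classes (X : finType) (P : {set X}) (U : X -> pred nat)
    (w h d : nat) :
  0 < w -> w <= h.+1 -> d <= 1 ->
  {in P &, forall x y, {in [pred i | i <= h], U x =1 U y} -> x = y} ->
  {in P, forall x i, U x i -> w <= i} ->
  {in P, forall x i, U x i -> U x (i + w)} ->
  {in P, forall x i j, U x i -> U x j -> i + j != h + d * w} ->
  #|P| ^ 2 <= \prod_(r < w) pair_count d (class_size w h r).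
Proof.
move=> w0 wh d1 U_inj U_ge U_add U_sum.
have part_lt r : (h - r) %% w < w by rewrite ltn_mod.
pose s (r : 'I_w) : 'I_w := Ordinal (part_lt r).
have rh (r : 'I_w) : r <= h by have := ltn_ord r; lia.
have class_eq (r : 'I_w) : r + s r + (class_size w h r).-1 * w = h.
  rewrite /class_size /= -addnA [_ %% _ + _]addnC -divn_eq subnKC //; exact: rh.
have s_mod (r : 'I_w) : h - s r = (class_size w h r).-1 * w + r.
  by rewrite -[X in X - _](class_eq r) addnAC addnK addnC.
have sK : involutive s.
  move=> r; apply: val_inj; rewrite [LHS]/= -/(s r) s_mod modnMDl modn_small //.
have ks (r : 'I_w) : class_size w h (s r) = class_size w h r.
  by rewrite /class_size s_mod divnMDl // divn_small // addn0.
(* Closure under adding w makes U a final segment of each class, so its first position there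
   determines it. *)
pose cnt (A : pred nat) r := find (fun j => A (r + j * w)) (iota 0 (class_size w h r)).
have U_mono x r j j' : x \in P -> j <= j' -> U x (r + j * w) -> U x (r + j' * w).
  move=> xP /subnK <-; elim: (j' - j) => // n IH /IH H.
  by rewrite addSn mulSn addnCA addnC; apply: U_add.
have cnt_le A r : cnt A r <= class_size w h r.
  by rewrite -[X in _ <= X](size_iota 0) find_size.
have cnt_mem x r j : x \in P -> j < class_size w h r ->
    U x (r + j * w) = (cnt (U x) r <= j).
  move=> xP jk; apply/idP/idP => [Uj|cj].
    rewrite leqNgt; apply/negP => /(before_find 0).
    by rewrite nth_iota // add0n Uj.
  have ck : cnt (U x) r < class_size w h r by apply: leq_ltn_trans jk.
  apply: U_mono cj _ => //.
  have := nth_find 0 (a := fun j => U x (r + j * w)) (s := iota 0 (class_size w h r)).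
  rewrite has_find size_iota => /(_ ck).
  by rewrite nth_iota.
have cnt_gt0 x (r : 'I_w) : x \in P -> 0 < cnt (U x) r.
  move=> xP; rewrite ltnNge -cnt_mem // mul0n addn0; apply/negP => /(U_ge _ xP).
  by rewrite leqNgt ltn_ord.
have size_lt (r : 'I_w) : class_size w h r < h.+2.
  by rewrite /class_size !ltnS; apply: leq_trans (leq_div _ _) (leq_subr _ _).
pose code x (r : 'I_w) : 'I_h.+2 := inord (cnt (U x) r).
have codeE x r : code x r = cnt (U x) r :> nat.
  by rewrite inordK //; apply: leq_ltn_trans (cnt_le _ _) (size_lt r).
have cnt_sum x (r : 'I_w) : x \in P ->
    class_size w h r + d <= cnt (U x) r + cnt (U x) (s r).
  (* Otherwise r + a w and s r + (k - 1 + d - a) w both lie in U, with the forbidden sum h + d w.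
     Positive counts and d <= 1 keep both positions below k. *)
  move=> xP; rewrite leqNgt; apply/negP => lt.
  have c0 := cnt_gt0 _ r xP; have c1 := cnt_gt0 _ (s r) xP.
  set k := class_size w h r in lt *.
  set a := cnt (U x) r in lt c0 *.
  have Ua : U x (r + a * w) by rewrite cnt_mem //; rewrite -/k; lia.
  have Ub : U x (s r + (k.-1 + d - a) * w).
    by rewrite cnt_mem ?ks // -/k; lia.
  have /eqP[] := U_sum _ xP _ _ Ua Ub.
  have e : a + (k.-1 + d - a) = k.-1 + d by lia.
  by rewrite addnACA -mulnDl e mulnDl addnA class_eq.
pose Q (r : 'I_w) := [set p : 'I_h.+2 * 'I_h.+2 |
  [&& 1 <= p.1 <= class_size w h r, 1 <= p.2 <= class_size w h r
    & class_size w h r + d <= p.1 + p.2]].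
apply: (@leq_trans (\prod_(r < w) #|Q r|)); last first.
  by apply: leq_prod => r _; apply: card_pairs_le.
apply: (card_sqr_le_prod (s := s) (code := code)) => //.
- move=> x y xP yP exy; apply: U_inj => // i; rewrite inE => ih.
  rewrite (divn_eq i w) addnC.
  have iw : i %% w < w by rewrite ltn_mod.
  have lt : i %/ w < class_size w h (Ordinal iw).
    rewrite /class_size ltnS leq_divRL //=; have := divn_eq i w; lia.
  have := exy (Ordinal iw) => /(congr1 val); rewrite /= !codeE /= => e.
  by rewrite !(cnt_mem _ (Ordinal iw)) //= e.
- move=> x xP r; rewrite inE /= !codeE cnt_gt0 ?cnt_le // cnt_gt0 //=.
  by rewrite -{1}ks cnt_le cnt_sum.
- move=> x y xP yP r sr; rewrite inE /= !codeE !cnt_gt0 ?cnt_le //=.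
  (* In a self-paired class each count is at least (k + d)/2, so counts of different sets may be
     mixed. *)
  have := cnt_sum _ r xP; have := cnt_sum _ r yP; rewrite sr; lia.
Qed.

Lemma card_pow_le_gap (X : finType) (P : {set X}) (U : X -> pred nat)
    (w h : nat) :
  0 < w -> w <= h.+1 ->
  {in P &, forall x y, {in [pred i | i <= h], U x =1 U y} -> x = y} ->
  {in P, forall x i, U x i -> w <= i} ->
  {in P, forall x i, U x i -> U x (i + w)} ->
  {in P, forall x i j, U x i -> U x j -> i + j != h} ->
  #|P| ^ 2 <= 2 ^ h.+1.
Proof.
move=> w0 wh U_inj U_ge U_add U_sum.
have := @card_sqr_le_classes X P U w h 0 w0 wh isT U_inj U_ge U_add.
rewrite mul0n addn0 => /(_ U_sum) /leq_trans; apply.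
rewrite -(sum_class_size w0 wh) expn_sum.
by apply: leq_prod => r _; apply: pair_count0_le.
Qed.

(** Class sizes are all 1 if w = h + 1 and at least 5 if 5w <= h, as [pair_count1_le] requires; its
    fifth power and the square give the exponent 10. *)
Lemma card_pow_le_shift (X : finType) (P : {set X}) (U : X -> pred nat)
    (w h : nat) :
  0 < w -> w = h.+1 \/ 5 * w <= h ->
  {in P &, forall x y, {in [pred i | i <= h], U x =1 U y} -> x = y} ->
  {in P, forall x i, U x i -> w <= i} ->
  {in P, forall x i, U x i -> U x (i + w)} ->
  {in P, forall x i j, U x i -> U x j -> i + j != h + w} ->
  #|P| ^ 10 <= 16 ^ h.+1.
Proof.
move=> w0 whs U_inj U_ge U_add U_sum.
have wh : w <= h.+1 by case: whs; lia.
have := @card_sqr_le_classes X P U w h 1 w0 wh isT U_inj U_ge U_add.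
rewrite mul1n => /(_ U_sum) le2.
have prod5 : (\prod_(r < w) pair_count 1 (class_size w h r)) ^ 5 =
    \prod_(r < w) pair_count 1 (class_size w h r) ^ 5.
  by apply: (big_morph (fun n => n ^ 5)) => // x y; exact: expnMn.
rewrite (expnM _ 2 5); apply: (@leq_trans (\prod_(r < w) pair_count 1 (class_size w h r) ^ 5)).
  by rewrite -prod5 leq_exp2r.
rewrite -(sum_class_size w0 wh) expn_sum.
apply: leq_prod => r _; apply: pair_count1_le.
have rw := ltn_ord r; rewrite /class_size ltnS.
case: whs => [e|le]; first by left; rewrite divn_small //; lia.
by right; rewrite leq_divRL //; lia.
Qed.

Local Open Scope classical_set_scope.

(** * Minimal generators and maximal embedding dimension *)

Lemma smallest_submonoid (A : set nat) : submonoid (smallest submonoid A).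
Proof.
split=> [B [[]] //|x y Ax Ay B BA].
by have [[_ B_add] _] := BA; apply: B_add; [apply: Ax|apply: Ay].
Qed.

Lemma subset_smallest (A : set nat) : A `<=` smallest submonoid A.
Proof. by move=> x Ax B [_]; apply. Qed.

Section MinimalGenerators.
Variables (A S : set nat).
Hypothesis minA : minimal_generators A S.

Let genA : smallest submonoid A = S. Proof. by case: minA. Qed.

Lemma minimal_generators_sub (a : nat) : A a -> S a.
Proof. by rewrite -genA; exact: subset_smallest. Qed.

Lemma minimal_generators_irredundant (a : nat) :
  A a -> ~ smallest submonoid (A `\ a) a.
Proof.
move=> Aa Ba.
suff e : A `\ a = A.
  by have [_ /(_ erefl)] : (A `\ a) a by rewrite e.
apply: minA.2; first by move=> x [].
rewrite /generates -genA; apply/seteqP; split=> x xA C [C_mon AC].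
  by apply: xA; split => // y [Ay _]; exact: AC.
apply: xA; split => // y Ay; have [->|/eqP ya] := eqVneq y a.
  by apply: Ba; split.
by apply: AC; split.
Qed.

Lemma minimal_generators_neq0 (a : nat) : A a -> a <> 0.
Proof.
move=> /minimal_generators_irredundant nB a0; apply: nB.
by rewrite {2}a0; case: (smallest_submonoid (A `\ a)).
Qed.

(** Both summands would be smaller than a, hence generated without a, and a would be redundant. *)
Lemma minimal_generators_irreducible (a x y : nat) :
  A a -> S x -> S y -> x <> 0 -> y <> 0 -> a <> x + y.
Proof.
move=> Aa Sx Sy x0 y0 axy; apply: (minimal_generators_irredundant Aa).
have [B0 B_add] := smallest_submonoid (A `\ a).
have lt_in z : S z -> z < a -> smallest submonoid (A `\ a) z.
  rewrite -genA => Az za.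
  (* As a condition on z, this disjunction defines a submonoid containing A. *)
  have : a <= z \/ smallest submonoid (A `\ a) z.
    apply: (Az [set z | a <= z \/ smallest submonoid (A `\ a) z]).
    split; [split|].
    - by right.
    - move=> u v /= [au|Bu] [av|Bv]; try by left; lia.
      by right; exact: B_add.
    - move=> u Au /=; have [->|/eqP ua] := eqVneq u a; first by left.
      by right; apply: subset_smallest; split.
  by case=> //; rewrite leqNgt za.
by rewrite [X in _ X]axy; apply: B_add; apply: lt_in => //; lia.
Qed.

End MinimalGenerators.

Lemma submonoid_muln (S : set nat) (m x j : nat) :
  submonoid S -> S m -> S x -> S (x + j * m).
Proof.
move=> [_ S_add] Sm Sx; elim: j => [|j IH]; first by rewrite addn0.
by rewrite mulSn addnCA; exact: S_add.
Qed.

Lemma eqmod_ltn (m a x : nat) :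
  a %% m = x %% m -> x < a -> exists j, a = x + j * m + m.
Proof.
move=> eax xa; have lt : x %/ m < a %/ m.
  rewrite ltn_neqAle leq_div2r ?(ltnW xa) // andbT; apply/eqP => e.
  by move: xa; rewrite (divn_eq x m) (divn_eq a m) eax e ltnn.
exists (a %/ m - x %/ m).-1; rewrite -addnA -mulSnr prednK ?subn_gt0 //.
rewrite {1}(divn_eq a m) eax {2}(divn_eq x m) addnAC -mulnDl.
by rewrite subnKC // ltnW.
Qed.

(* Minimal generators are incongruent modulo m, so if there are m of them they
   represent every class, in particular that of x + y; were x + y - m not in S,
   the representative would be reducible. *)
Lemma MED_subr_closed (S : set nat) (m : nat) :
  submonoid S -> max_embedding_dimension S -> is_multiplicity S m ->
  forall x y : nat, S x -> S y -> x <> 0 -> y <> 0 -> S (x + y - m).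
Proof.
move=> S_mon [e [[A [minA cardA]] [Se e0 e_le]]] [Sm m0 m_le].
have em : e = m by apply/eqP; rewrite eqn_leq e_le // m_le.
subst e.
have m_gt0 : 0 < m by lia.
have reducible a x : A a -> S x -> x <> 0 -> a %% m = x %% m -> a <= x.
  move=> Aa Sx x0 eax; rewrite leqNgt; apply/negP => xa.
  have [j e] := eqmod_ltn eax xa.
  apply: (minimal_generators_irreducible minA Aa _ Sm _ m0 e); last by lia.
  exact: submonoid_muln.
have inj_mod a b : A a -> A b -> a %% m = b %% m -> a = b.
  move=> Aa Ab ab; apply/eqP; rewrite eqn_leq !reducible //.
  - exact: minimal_generators_sub minA _ Aa.
  - exact: minimal_generators_neq0 minA _ Aa.
  - exact: minimal_generators_sub minA _ Ab.
  - exact: minimal_generators_neq0 minA _ Ab.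
have surj_mod r : r < m -> exists2 a, A a & a %% m = r.
  move: cardA; rewrite card_eq_sym => /card_set_bijP[g [gA g_inj _]] rm.
  have part_lt (i : 'I_m) : g i %% m < m by rewrite ltn_mod.
  pose h (i : 'I_m) : 'I_m := Ordinal (part_lt i).
  have h_inj : injective h.
    move=> i j /(congr1 val) /= hij; apply: val_inj => /=.
    apply: g_inj; rewrite ?inE /=; try exact: ltn_ord.
    by apply: inj_mod hij; apply: gA => /=; exact: ltn_ord.
  have [h' _ hK] := injF_bij h_inj.
  exists (g (h' (Ordinal rm))); first by apply: gA => /=; exact: ltn_ord.
  by have /(congr1 val) := hK (Ordinal rm).
move=> x y Sx Sy x0 y0.
have xym : (x + y) %% m < m by rewrite ltn_mod.
have [a Aa axy] := surj_mod _ xym.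
have Sxy : S (x + y) by exact: S_mon.2.
have le : a <= x + y by apply: reducible => //; lia.
have ne := minimal_generators_irreducible minA Aa Sx Sy x0 y0.
have [j ->] : exists j, x + y = a + j * m + m.
  apply: eqmod_ltn; first by rewrite axy.
  by rewrite ltn_neqAle le andbT; apply/eqP.
rewrite addnK; apply: submonoid_muln => //.
exact: minimal_generators_sub minA _ Aa.
Qed.

(** The irreducible elements are the minimal generators, and reduction modulo m maps them
    bijectively to the residues: the least nonzero w of S in its class is irreducible, since w = x +
    y would put the smaller x + y - m in that class. *)
Lemma MED_of_subr_closed (S : set nat) (m N : nat) :
  submonoid S -> (forall x, N < x -> S x) -> is_multiplicity S m ->
  (forall x y : nat, S x -> S y -> x <> 0 -> y <> 0 -> S (x + y - m)) ->
  max_embedding_dimension S.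
Proof.
move=> S_mon S_gt [Sm m0 m_le] S_sub.
have m_gt0 : 0 < m by lia.
exists m; split; last by split.
pose A := [set a | [/\ S a, a <> 0 &
  forall x y : nat, S x -> S y -> x <> 0 -> y <> 0 -> a <> x + y]].
exists A; split; first split.
- apply/seteqP; split=> [x Ax|x Sx].
    by apply: (Ax S); split => // a [].
  elim/ltn_ind: x Sx => x IH Sx.
  have [A0 A_add] := smallest_submonoid A.
  have [->|/eqP x0] := eqVneq x 0; first exact: A0.
  have [Ax|nAx] := pselect (A x); first exact: subset_smallest.
  have [u [v [Su Sv u0 v0 xuv]]] : exists u v,
      [/\ S u, S v, u <> 0, v <> 0 & x = u + v].
    apply: contrapT => nex; apply: nAx; split => // u v Su Sv u0 v0 xuv.
    by apply: nex; exists u, v.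
  by rewrite xuv; apply: A_add; apply: IH => //; lia.
- move=> B BA genB; apply/seteqP; split => // a [Sa a0 a_irr].
  apply: contrapT => nBa.
  have : smallest submonoid B a by rewrite genB.
  (* Removing an irreducible a from S leaves a submonoid, so every generating set contains a. *)
  move=> /(_ [set z | S z /\ z <> a]) [] //.
  split; first split => /=.
  + by split; [exact: S_mon.1|lia].
  + move=> x y [Sx xa] [Sy ya]; split; first exact: S_mon.2.
    have [->|/eqP x0] := eqVneq x 0; first by [].
    have [->|/eqP y0] := eqVneq y 0; first by rewrite addn0.
    by move=> e; apply: (a_irr x y).
  + move=> b Bb; split; first by have [] := BA _ Bb.
    by move=> ba; apply: nBa; rewrite -ba.
apply/card_set_bijP; exists (fun a => a %% m); split.
- by move=> a _ /=; rewrite ltn_mod.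
- move=> a b; rewrite !inE.
  have key a' b' : A a' -> A b' -> a' %% m = b' %% m -> a' <= b'.
    move=> [Sa a0 a_irr] [Sb b0 b_irr] eab; rewrite leqNgt; apply/negP => lt.
    have [j e] := eqmod_ltn eab lt.
    apply: (a_irr (b' + j * m) m) => //; last by lia.
    exact: submonoid_muln.
  by move=> Aa Ab eab; apply/eqP; rewrite eqn_leq !key.
- move=> r /= rm.
  pose P x := [&& `[< S x >], x != 0 & x %% m == r].
  have exP : exists x, P x.
    exists (N.+1 * m + r); rewrite /P; apply/and3P; split.
    + by apply/asboolP; apply: S_gt; nia.
    + by rewrite addn_eq0 muln_eq0 /= gtn_eqF.
    + by rewrite modnMDl modn_small.
  case: (ex_minnP exP) => w /and3P[/asboolP Sw /eqP w0 /eqP wr] w_min.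
  exists w => //; split => // x y Sx Sy x0 y0 wxy.
  have xm := m_le _ Sx x0; have ym := m_le _ Sy y0.
  have /w_min : P (x + y - m); last by lia.
  apply/and3P; split.
  + by apply/asboolP; exact: S_sub.
  + by apply/eqP; lia.
  + by rewrite -wr wxy -[in X in _ == X](@subnK m (x + y)) ?modnDr //; lia.
Qed.

(* Subsets of [0, f], completed by everything above f, encode the semigroups
   with Frobenius number f. *)
Definition fill (f : nat) (A : {set 'I_f.+1}) : set nat :=
  [set x | f < x \/ exists2 i : 'I_f.+1, i \in A & x = i].

Definition trace (f : nat) (S : set nat) : {set 'I_f.+1} :=
  finset (fun i : 'I_f.+1 => `[< S i >]).

Definition MED_traces (f : nat) : {set {set 'I_f.+1}} :=
  finset (fun A : {set 'I_f.+1} => `[< MED_semigroups f (fill A) >]).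

Lemma fill_ord (f : nat) (A : {set 'I_f.+1}) (i : 'I_f.+1) : fill A i <-> i \in A.
Proof.
split=> [[|[j jA /val_inj -> //]]|iA]; last by right; exists i.
by have := ltn_ord i; lia.
Qed.

Lemma fill_inj (f : nat) : injective (@fill f).
Proof.
by move=> A B AB; apply/setP => i; apply/idP/idP => /fill_ord iA;
  apply/fill_ord; rewrite ?AB // -AB.
Qed.

Lemma trace_fill (f : nat) (S : set nat) :
  (forall x, f < x -> S x) -> fill (trace f S) = S.
Proof.
move=> S_gt; apply/seteqP; split=> x.
  by case=> [/S_gt //|[i]]; rewrite inE => /asboolP Si ->.
move=> Sx; have [fx|xf] := ltnP f x; first by left.
have xf1 : x < f.+1 by [].
by right; exists (Ordinal xf1) => //; rewrite inE; apply/asboolP.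
Qed.

Lemma frobenius_gt (S : set nat) (f x : nat) :
  is_frobenius_number S f -> f < x -> S x.
Proof. by move=> [_ S_le] fx; apply: contrapT => /S_le; lia. Qed.

(** Listing the images under [fill] shows that the set of semigroups is finite, so that [fset_set]
    has its intended value. *)
Lemma MED_card_traces (f : nat) : MED f = #|MED_traces f|.
Proof.
pose l := map (@fill f) (enum (MED_traces f)).
have l_uniq : uniq l by rewrite map_inj_uniq ?enum_uniq //; exact: fill_inj.
pose F : {fset (set nat)} := seq_fset tt l.
have eql : MED_semigroups f = [set` F].
  apply/seteqP; split=> S /=; rewrite /F seq_fsetE.
    move=> MS; have [_ S_frob _] := MS.
    have e : fill (trace f S) = S.
      by apply: trace_fill => x; exact: frobenius_gt S_frob.
    apply/mapP; exists (trace f S) => //.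
    by rewrite mem_enum inE e; apply/asboolP.
  by move=> /mapP[A]; rewrite mem_enum inE => /asboolP MA ->.
by rewrite /MED eql set_fsetK size_seq_fset undup_id // size_map -cardE.
Qed.

(** * Upper bound: splitting by multiplicity *)

Lemma leq_card_cover (X : finType) (P : {set X}) (Q : nat -> {set X}) (n : nat) :
  {in P, forall x, exists2 i, i < n & x \in Q i} -> #|P| <= \sum_(i < n) #|Q i|.
Proof.
move=> PQ; rewrite -sum1_card.
under [leqRHS]eq_bigr do rewrite -sum1_card big_mkcond.
rewrite exchange_big [leqLHS]big_mkcond /=; apply: leq_sum => x _.
case: ifP => // /PQ[i ilt xQ].
by rewrite (bigD1 (Ordinal ilt)) //= xQ.
Qed.

(** Comparison with n times the largest piece stays within k-th powers and takes no root of E. *)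
Lemma card_cover_pow (X : finType) (P : {set X}) (Q : nat -> {set X}) (n k E : nat) :
  {in P, forall x, exists2 i, i < n & x \in Q i} ->
  0 < k -> (forall i, i < n -> #|Q i| ^ k <= E) -> #|P| ^ k <= n ^ k * E.
Proof.
move=> /leq_card_cover le k0 QE.
have sum_le : \sum_(i < n) #|Q i| <= n * \max_(i < n) #|Q i|.
  rewrite -[X in _ <= X * _](card_ord n) -sum_nat_const.
  by apply: leq_sum => i _; exact: leq_bigmax.
apply: (@leq_trans ((n * \max_(i < n) #|Q i|) ^ k)).
  by rewrite leq_exp2r //; exact: leq_trans sum_le.
rewrite expnMn leq_mul2l; apply/orP; right.
apply: (big_ind (fun b => b ^ k <= E)); first by rewrite exp0n.
  by move=> x y; rewrite /maxn; case: ifP.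
by move=> i _; exact: QE.
Qed.

Definition MED_traces_mult (f m : nat) : {set {set 'I_f.+1}} :=
  finset (fun A => (A \in MED_traces f) && `[< is_multiplicity (fill A) m >]).

Lemma MED_traces_multP (f m : nat) (A : {set 'I_f.+1}) :
  A \in MED_traces_mult f m ->
  [/\ submonoid (fill A), ~ fill A f, is_multiplicity (fill A) m &
   forall x y, fill A x -> fill A y -> x <> 0 -> y <> 0 -> fill A (x + y - m)].
Proof.
rewrite inE => /andP[]; rewrite inE => /asboolP[[A_mon _] [nAf _] A_med] /asboolP mA.
by split => //; exact: MED_subr_closed.
Qed.

Lemma fill_ext (f : nat) (A B : {set 'I_f.+1}) :
  (forall x, x <= f -> fill A x <-> fill B x) -> A = B.
Proof.
move=> AB; apply/setP => i; have [AB1 AB2] := AB i (ltn_ord i).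
by apply/idP/idP => /fill_ord => [/AB1|/AB2] /fill_ord.
Qed.

(** Nonzero elements of sum f + m would put f itself in the semigroup. *)
Lemma card_MED_traces_mult_small (f m : nat) :
  0 < m -> m = f.+1 \/ 5 * m <= f -> #|MED_traces_mult f m| ^ 10 <= 16 ^ f.+1.
Proof.
move=> m0 mf.
apply: (@card_pow_le_shift _ _ (fun A i => (i != 0) && `[< fill A i >]) m f) => //.
- move=> A B /MED_traces_multP[[A0 _] _ _ _] /MED_traces_multP[[B0 _] _ _ _] AB.
  apply: fill_ext => x xf; have := AB x; rewrite inE => /(_ xf).
  have [->|x0 /=] := eqVneq x 0; first by [].
  by move=> e; split=> [/asboolP|/asboolP]; [rewrite e|rewrite -e] => /asboolP.
- move=> A /MED_traces_multP[_ _ [_ _ m_le] _] i /andP[/eqP i0 /asboolP Ai].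
  exact: m_le.
- move=> A /MED_traces_multP[[_ A_add] _ [Am _ _] _] i /andP[i0 /asboolP Ai].
  by apply/andP; split; [lia|apply/asboolP; exact: A_add].
- move=> A /MED_traces_multP[_ nAf _ A_sub] i j.
  move=> /andP[/eqP i0 /asboolP Ai] /andP[/eqP j0 /asboolP Aj]; apply/eqP => e.
  by have := A_sub i j Ai Aj i0 j0; rewrite e addnK.
Qed.

Lemma card_MED_traces_mult_large (f m : nat) :
  0 < m -> m <= f ->
  #|MED_traces_mult f m| ^ 2 <= (f - m).+1 ^ 2 * 2 ^ (f - m).+1.
Proof.
move=> m0 mf.
(* Here i + 1 is the multiplicity of T = S* - m. *)
pose Q i := finset (fun A => (A \in MED_traces_mult f m) &&
  `[< fill A (m + i.+1) /\ forall t, t <> 0 -> fill A (m + t) -> i < t >]).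
apply: (@card_cover_pow _ _ Q) => //.
  move=> A AM; pose P t := `[< fill A (m + t.+1) >].
  (* Since f + 1 is in S, f - m + 1 is in T, whence i <= f - m. *)
  have fP : P (f - m) by apply/asboolP; left; lia.
  case: (ex_minnP (ex_intro P _ fP)) => i /asboolP Pi i_min.
  exists i; first by rewrite ltnS; exact: i_min.
  rewrite inE AM; apply/asboolP; split => // -[//|t] _ At.
  by rewrite ltnS; apply: i_min; apply/asboolP.
move=> i ifm.
have QP A : A \in Q i -> A \in MED_traces_mult f m /\
    (fill A (m + i.+1) /\ forall t, t <> 0 -> fill A (m + t) -> i < t).
  by rewrite inE => /andP[? /asboolP].
apply: (@card_pow_le_gap _ _ (fun A t => (t != 0) && `[< fill A (m + t) >]) i.+1 (f - m)) => //.
- move=> A B /QP[/MED_traces_multP[[A0 _] _ [Am _ mA] _] _].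
  move=> /QP[/MED_traces_multP[[B0 _] _ [Bm _ mB] _] _] AB.
  apply: fill_ext => x xf.
  have [->|/eqP x0] := eqVneq x 0; first by [].
  have [->|xm] := eqVneq x m; first by [].
  have [mx|xlt] := leqP m x; last first.
    by split=> [/mA|/mB] /(_ x0); lia.
  have := AB (x - m); rewrite inE subnKC // leq_sub2r // => /(_ isT).
  have -> /= : x - m != 0 by lia.
  by move=> e; split=> [/asboolP|/asboolP]; [rewrite e|rewrite -e] => /asboolP.
- by move=> A /QP[_ [_ le]] t /andP[/eqP t0 /asboolP At]; exact: le.
- move=> A /QP[/MED_traces_multP[_ _ _ A_sub] [Ai _]] t /andP[/eqP t0 /asboolP At].
  apply/andP; split; first by lia.
  apply/asboolP; have := A_sub _ _ At Ai.
  rewrite (_ : m + t + (m + i.+1) - m = m + (t + i.+1)); last by lia.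
  by apply; lia.
- move=> A /QP[/MED_traces_multP[_ nAf _ A_sub] _] s t.
  move=> /andP[/eqP s0 /asboolP As] /andP[/eqP t0 /asboolP At]; apply/eqP => e.
  apply: nAf; have := A_sub _ _ As At.
  rewrite (_ : m + s + (m + t) - m = f); last by lia.
  by apply; lia.
Qed.

(** Small m gives 16^(f+1) = 2^(4f+4); large m gives 2^(5(f-m+1)) with 5m > f. One factor (f+1)^10
    pays for the choice of m, the other for the multiplicity of T. *)
Lemma MED_pow_le (f : nat) : MED f ^ 10 <= f.+1 ^ 10 * (f.+1 ^ 10 * 2 ^ (4 * f + 5)).
Proof.
rewrite MED_card_traces.
apply: (@card_cover_pow _ _ (fun i => MED_traces_mult f i.+1)) => //.
  move=> A AM; have := AM; rewrite inE => /asboolP[_ A_frob [m [_ mA]]].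
  have [_ m0 m_le] := mA.
  have mf : m <= f.+1 by apply: m_le => //; left.
  exists m.-1; first by lia.
  by rewrite prednK; [rewrite inE AM; apply/asboolP|lia].
move=> i lt_if.
have pow16 : 16 ^ f.+1 <= 2 ^ (4 * f + 5).
  by rewrite (_ : 16 = 2 ^ 4) // -expnM leq_exp2l //; lia.
have f_gt0 : 0 < f.+1 ^ 10 by rewrite expn_gt0.
have [small|large] : (i.+1 = f.+1 \/ 5 * i.+1 <= f) \/ (i.+1 <= f /\ f < 5 * i.+1) by lia.
  apply: leq_trans (card_MED_traces_mult_small _ small) _ => //.
  by apply: leq_trans pow16 _; rewrite leq_pmull.
have [le lt5] := large.
have := card_MED_traces_mult_large (ltn0Sn i) le.
rewrite -(@leq_exp2r _ _ 5) // -expnM => /leq_trans; apply.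
rewrite expnMn -!expnM; apply: leq_mul.
  by rewrite leq_exp2r //; lia.
by rewrite leq_exp2l //; lia.
Qed.

(** * Lower bound: explicit families *)

Lemma card_le_MED (f : nat) (T : finType) (F : T -> set nat) :
  injective F -> (forall t, MED_semigroups f (F t)) -> #|T| <= MED f.
Proof.
move=> F_inj MF; rewrite MED_card_traces.
have FK t : fill (trace f (F t)) = F t.
  by apply: trace_fill => x; have [_ F_frob _] := MF t; exact: frobenius_gt F_frob.
have trF_inj : injective (fun t => trace f (F t)).
  by move=> s t /(congr1 (@fill f)); rewrite !FK => /F_inj.
rewrite -(card_codom trF_inj); apply: subset_leq_card.
apply/fintype.subsetP => _ /codomP[t ->]; rewrite inE FK; exact/asboolP.
Qed.

Lemma MED_semigroups_intro (f m : nat) (S : set nat) :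
  submonoid S -> is_multiplicity S m -> ~ S f -> (forall x, f < x -> S x) ->
  (forall x y, S x -> S y -> x <> 0 -> y <> 0 -> S (x + y - m)) ->
  MED_semigroups f S.
Proof.
move=> S_mon Sm nSf S_gt S_sub; split.
- split => //; apply: (@sub_finite_set _ _ `I_f.+1); last exact: finite_II.
  by move=> x nSx /=; rewrite ltnS leqNgt; apply/negP => /S_gt.
- by split => // x nSx; rewrite leqNgt; apply/negP => /S_gt.
- exact: MED_of_subr_closed S_mon S_gt Sm S_sub.
Qed.

Lemma MED_gt0 (f : nat) : 0 < f -> 0 < MED f.
Proof.
move=> f0; rewrite -[X in X <= _]card_unit.
apply: (@card_le_MED f unit (fun=> [set x | x = 0 \/ f < x])) => [[] [] //|_].
apply: (@MED_semigroups_intro f f.+1).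
- by split => /= [|x y]; lia.
- by split => /= [||x]; lia.
- by move=> /=; lia.
- by move=> x /=; lia.
- by move=> x y /=; lia.
Qed.

(** Nonzero elements other than m are at least 2m, so x + y - m is x or y when one of them is m, and
    otherwise at least 3m > f. *)
Lemma pow_le_MED (f m : nat) : 2 * m < f -> f < 3 * m -> 2 ^ (f - (2 * m).+1) <= MED f.
Proof.
move=> mf fm; set n := f - (2 * m).+1.
pose F (B : {set 'I_n}) := [set x | [\/ x = 0, x = m, x = 2 * m | f < x] \/
  exists2 i : 'I_n, i \in B & x = (2 * m).+1 + i].
have F_in B (i : 'I_n) : F B ((2 * m).+1 + i) -> i \in B.
  have := ltn_ord i; rewrite /n => iN [[]|[j jB]]; try by lia.
  by move=> /addnI/val_inj ->.
have F_cases B x : F B x -> [\/ x = 0, x = m | 2 * m <= x].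
  case=> [[]|[i iB]] e; [exact: Or31|exact: Or32| |by apply: Or33; lia|].
    by apply: Or33; rewrite e.
  by apply: Or33; rewrite e; lia.
have F_gt B x : f < x -> F B x by move=> fx; left; apply: Or44.
rewrite -[n]card_ord -cardsT -card_powerset -[X in X <= _]cardsE.
rewrite (_ : finset _ = [set: {set 'I_n}]%SET); last first.
  by apply/setP => B; rewrite !inE finset.subsetT.
rewrite cardsT; apply: (@card_le_MED f _ F).
  move=> B C BC; apply/setP => i; apply/idP/idP => iB; apply: F_in.
    by rewrite -BC; right; exists i.
  by rewrite BC; right; exists i.
move=> B; apply: (@MED_semigroups_intro f m).
- split; first by left; apply: Or41.
  move=> x y Fx Fy.
  case: (F_cases _ _ Fx) => [->//|xm|xm].
    case: (F_cases _ _ Fy) => [->|ym|ym]; first by rewrite addn0.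
      by left; apply: Or43; lia.
    by apply: F_gt; lia.
  case: (F_cases _ _ Fy) => [->|ym|ym]; first by rewrite addn0.
    by apply: F_gt; lia.
  by apply: F_gt; lia.
- split; first by left; apply: Or42.
    by lia.
  by move=> x /F_cases[]; lia.
- case=> [[]|[i iB e]]; try by lia.
  by move: (nat_of_ord i) (ltn_ord i) e => j; rewrite /n; lia.
- exact: F_gt.
- move=> x y Fx Fy x0 y0.
  case: (F_cases _ _ Fx) => [//|->|xm]; first by rewrite addKn.
  case: (F_cases _ _ Fy) => [//|->|ym]; first by rewrite addnK.
  by apply: F_gt; lia.
Qed.

(** Taking m = [f %/ 3] + 1 costs a factor 2^3, whence the 8; this m satisfies 2m < f from f = 7
    on. *)
Lemma pow_le_MED_cube (f : nat) : 0 < f -> 2 ^ f <= (8 * MED f) ^ 3.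
Proof.
move=> f0; have [f6|f7] := leqP f 6.
  apply: (@leq_trans (2 ^ 6)); first by rewrite leq_exp2l.
  apply: (@leq_trans (8 ^ 3)) => //.
  by rewrite leq_exp2r // -{1}[8]muln1 leq_mul2l MED_gt0.
have le : 2 ^ (f - (2 * (f %/ 3).+1).+1) <= MED f by apply: pow_le_MED; lia.
have : 2 ^ (f - 2 * (f %/ 3)) <= 8 * MED f.
  rewrite (_ : f - _ = 3 + (f - (2 * (f %/ 3).+1).+1)); last by lia.
  by rewrite expnD leq_mul2l.
rewrite -(@leq_exp2r _ _ 3) // -expnM; apply: leq_trans.
by rewrite leq_exp2l //; lia.
Qed.

Local Close Scope classical_set_scope.

(** * Passage to real exponents *)

(** Absorbs a polynomial factor into an exponential of small rate 1/q. *)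
Lemma succ_le_pow (q f : nat) : 0 < q -> f.+1 <= q * 2 ^ (f %/ q).
Proof.
move=> q0; apply: (@leq_trans (q * (f %/ q).+1)).
  by rewrite mulnC ltn_ceil.
by rewrite leq_mul2l ltn_expl // orbT.
Qed.

Local Open Scope ring_scope.
Import Order.TTheory GRing.Theory Num.Theory.

Lemma pow2E (R : realType) (n : nat) : ((2 ^ n)%N)%:R = 2 `^ n%:R :> R.
Proof. by rewrite natrX powR_mulrn. Qed.

Lemma powR_pow_mul (R : realType) (a x : R) (n : nat) : (a `^ x) ^+ n = a `^ (x * n%:R).
Proof. by rewrite powRrM powR_mulrn // powR_ge0. Qed.

Theorem theorem1p5 (R : realType) :
  exists c c' : R, [/\ 0 < c, 0 < c' &
    forall f : nat, (0 < f)%N ->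
      c * 2 `^ (1 / 3 * f%:R) < (MED f)%:R < c' * 2 `^ ((41 / 10 ^+ 2 + 385 / 10 ^+ 5) * f%:R)].
Proof.
(* Strict inequality comes from 1/16 < 1/8 and from 90000 > 2 * 200^2. *)
exists (1 / 16), (9 * 10 ^+ 4); split; [lra|by rewrite mulr_gt0 // exprn_gt0|].
move=> f f0.
have MED0 : 0 < (MED f)%:R :> R by rewrite ltr0n MED_gt0.
apply/andP; split.
  have : 2 `^ (1 / 3 * f%:R) <= 8 * (MED f)%:R :> R; last by lra.
  rewrite -(@ler_pXn2r _ 3) ?nnegrE ?powR_ge0 //.
  rewrite powR_pow_mul (_ : 1 / 3 * f%:R * 3%:R = f%:R); last by field.
  by rewrite -pow2E -natrM -natrX ler_nat pow_le_MED_cube.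
(* With q = 200 the square of f + 1 adds 2/200 to the rate 2/5, giving 0.41 < 0.41385. *)
have succ_le : f.+1%:R <= 200 * 2 `^ (f%:R / 200) :> R.
  apply: (@le_trans _ _ (200 * 2 `^ (f %/ 200)%:R)).
    by rewrite -pow2E -natrM ler_nat succ_le_pow.
  rewrite ler_wpM2l // ler_powR ?ler1n // ler_pdivlMr // -natrM ler_nat.
  exact: leq_divM.
have MED_le : (MED f)%:R <= f.+1%:R ^+ 2 * 2 `^ (2 / 5 * f%:R + 1 / 2) :> R.
  have Y0 : 0 <= f.+1%:R ^+ 2 * 2 `^ (2 / 5 * f%:R + 1 / 2) :> R.
    by rewrite mulr_ge0 ?exprn_ge0 ?powR_ge0.
  rewrite -(@ler_pXn2r _ 10) ?nnegrE // exprMn powR_pow_mul -exprM.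
  rewrite (_ : (_ + _) * _ = (4 * f + 5)%N%:R); last first.
    by rewrite natrD natrM; lra.
  by rewrite -pow2E -!natrX -natrM ler_nat (expnD _ 10 10) -mulnA MED_pow_le.
have le1 : (MED f)%:R <= (200 * 2 `^ (f%:R / 200)) ^+ 2 * 2 `^ (2 / 5 * f%:R + 1 / 2) :> R.
  apply: (le_trans MED_le); rewrite ler_wpM2r ?powR_ge0 //.
  by rewrite ler_pXn2r ?nnegrE // mulr_ge0 ?powR_ge0.
apply: (le_lt_trans le1).
rewrite exprMn powR_pow_mul -[ltLHS]mulrA -powRD; last by rewrite pnatr_eq0 implybT.
set Z := 2 `^ ((41 / _ + _) * _).
have Z0 : 0 < Z by rewrite powR_gt0.
have le2 : 2 `^ (f%:R / 200 * 2%:R + (2 / 5 * f%:R + 1 / 2)) <= 2 * Z.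
  rewrite -[X in _ <= X * _](@powRr1 _ 2) // -powRD; last by rewrite pnatr_eq0 implybT.
  rewrite ler_powR ?ler1n //.
  have : 0 <= f%:R :> R by [].
  by lra.
nra.
Qed.
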